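(* Let $n\ge2$. There exist $r>0$ and a solution $v=v(d,t,s)$ of the linear equation $$d^2 v_{dd}+d^2 v_{tt}+d\,v_{ss}-(n-1)d\,v_d-(n+1)v=0$$ in $$G_r=\{d\in\mathbb{R}:0<d<r\}\times\{(t,s)\in\mathbb{R}^2:\ t^2+s^2<r^2\}$$ such that: (i) $v$ belongs to the Gevrey space of order $2$ in the tangential variables: there are constants $D,B>0$ such that every partial derivative of $v$ of order $p$ in the variables $(t,s)$ is bounded in absolute value by $DB^p(p!)^2$ in $G_r$, for every $p\in\mathbb{N}$; (ii) $v$ is not analytic in $(d,t)$: the function $(d,t)\mapsto v(d,t,0)$ is not real analytic up to $d=0$ near the origin, i.e. in no neighborhood of the origin in $[0,\infty)\times\mathbb{R}$ is it the restriction of a real analytic function defined near the origin in $\mathbb{R}^2$.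
   Context: Subscripts $d,t,s$ denote partial derivatives; $d>0$ is an independent variable, and $\{d=0\}$ is the boundary on which the equation degenerates. *)

(* Defs.v *)
From Stdlib Require Import Reals List Factorial.
From Coquelicot Require Import Coquelicot.
Open Scope R_scope.

Inductive coord : Set := Cd | Ct | Cs.

Definition slice (i : coord) (f : R -> R -> R -> R) (d t s : R) : R -> R :=
  match i with
  | Cd => fun x => f x t s
  | Ct => fun x => f d x s
  | Cs => fun x => f d t x
  end.

Definition coord_val (i : coord) (d t s : R) : R :=
  match i with Cd => d | Ct => t | Cs => s end.

Definition partial (i : coord) (f : R -> R -> R -> R) : R -> R -> R -> R :=
  fun d t s => Derive (slice i f d t s) (coord_val i d t s).

Definition ex_partial (i : coord) (f : R -> R -> R -> R) (d t s : R) : Prop :=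
  ex_derive (slice i f d t s) (coord_val i d t s).

(* The last entry of the list is differentiated first. *)
Definition iter_partial (l : list coord) (f : R -> R -> R -> R) :
    R -> R -> R -> R :=
  fold_right partial f l.

Definition G (r d t s : R) : Prop := 0 < d < r /\ t ^ 2 + s ^ 2 < r ^ 2.

(* C^oo on an open set: [Derive] is a total function, so the existence of each
   derivative is required separately. *)
Definition smooth_on (U : R -> R -> R -> Prop) (f : R -> R -> R -> R) : Prop :=
  forall (l : list coord) (d t s : R), U d t s ->
    (forall i : coord, ex_partial i (iter_partial l f) d t s) /\
    continuous (fun q : R * (R * R) =>
                  iter_partial l f (fst q) (fst (snd q)) (snd (snd q)))
               (d, (t, s)).

Definition solves_on (n : nat) (U : R -> R -> R -> Prop)
    (v : R -> R -> R -> R) : Prop :=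
  forall d t s : R, U d t s ->
    d ^ 2 * iter_partial (Cd :: Cd :: nil) v d t s
    + d ^ 2 * iter_partial (Ct :: Ct :: nil) v d t s
    + d * iter_partial (Cs :: Cs :: nil) v d t s
    - (INR n - 1) * d * iter_partial (Cd :: nil) v d t s
    - (INR n + 1) * v d t s = 0.

(* [~ In Cd l]: only derivatives in (t, s), taken in any order. *)
Definition tangential_gevrey2_on (U : R -> R -> R -> Prop)
    (v : R -> R -> R -> R) : Prop :=
  exists D B : R, 0 < D /\ 0 < B /\
    forall (p : nat) (l : list coord), length l = p -> ~ In Cd l ->
    forall d t s : R, U d t s ->
      Rabs (iter_partial l v d t s) <= D * B ^ p * (INR (fact p)) ^ 2.

(* Near [z], [F] is the sum of an absolutely convergent double power series
   centred at [z]; the series is summed by homogeneous degree. *)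
Definition real_analytic_at (F : R * R -> R) (z : R * R) : Prop :=
  exists (c : nat -> nat -> R) (rho : R), 0 < rho /\
    forall h k : R, Rabs h < rho -> Rabs k < rho ->
      ex_series (fun m : nat =>
        sum_f_R0 (fun i => Rabs (c i (m - i)%nat * h ^ i * k ^ (m - i))) m) /\
      is_series (fun m : nat =>
        sum_f_R0 (fun i => c i (m - i)%nat * h ^ i * k ^ (m - i)) m)
        (F (fst z + h, snd z + k)).

(* [w] is only meaningful for positive first argument, so [F] has to agree
   with it there, and not on the boundary line itself. *)
Definition analytic_up_to_boundary_at_origin (w : R -> R -> R) : Prop :=
  exists F : R * R -> R,
    locally (0, 0) (fun z : R * R => real_analytic_at F z) /\
    locally (0, 0) (fun z : R * R => 0 < fst z -> F z = w (fst z) (snd z)).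

(* Main.v *)
(** Separation of variables gives, for [c ^ 2 = n + 3] and every [rho >= 0], the solution
    [d ^ (n + 1) * exp (- rho * d) * cos (rho * t) * exp (c * sqrt rho * s)].
    Superposing these for [rho = k ^ 2] with the weights [exp (- k)], the series converges
    for [|c * s| < 1]; each t-derivative costs a factor [k ^ 2] against the weight
    [exp (- k)], which is exactly Gevrey order 2.  At [t = s = 0], analyticity up to
    [d = 0] would make [sum_k exp (- k - k ^ 2 * d)] a convergent power series in [d],
    but its p-th derivative at [0+] is of size at least [p ^ (2 * p) * exp (- p)]. *)
Require Import Defs.
From Stdlib Require Import Reals List Factorial Lra Lia.
From Coquelicot Require Import Coquelicot.
Open Scope R_scope.

(** * Termwise differentiation of series *)

(** A summable bound on second derivatives replaces uniform convergence: two uses of the mean value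
    theorem bound each Taylor remainder by [M k * (y - x) ^ 2], and summing leaves an error of at
    most [Series M * Rabs u] in the difference quotient. *)
Lemma is_derive_Series (f g h : nat -> R -> R) (M : nat -> R) (lo hi x : R) :
  (forall k y, lo < y < hi -> is_derive (f k) y (g k y)) ->
  (forall k y, lo < y < hi -> is_derive (g k) y (h k y)) ->
  (forall y, lo < y < hi -> ex_series (fun k => f k y)) ->
  ex_series (fun k => g k x) ->
  (forall k y, lo < y < hi -> Rabs (h k y) <= M k) ->
  ex_series M -> lo < x < hi ->
  is_derive (fun y => Series (fun k => f k y)) x (Series (fun k => g k x)).
Proof.
intros Df Dg Sf Sg Hh SM Hx.
assert (between : forall y z, lo < y < hi -> Rmin x y <= z <= Rmax x y ->
          lo < z < hi /\ Rabs (z - x) <= Rabs (y - x)).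
{ intros y z Hy Hz. unfold Rmin, Rmax in Hz.
  destruct (Rle_dec x y); split; try lra; unfold Rabs; repeat destruct Rcase_abs; lra. }
assert (taylor : forall k y, lo < y < hi ->
          Rabs (f k y - f k x - g k x * (y - x)) <= M k * (y - x) ^ 2).
{ intros k y Hy.
  destruct (MVT_gen (f k) x y (g k)) as [z [Hz Ez]].
  { intros z Hz. apply Df. apply (between y z Hy). lra. }
  { intros z Hz. apply continuity_pt_filterlim, (ex_derive_continuous (V := R_NormedModule)).
    exists (g k z). apply Df. now apply (between y z Hy). }
  destruct (between y z Hy Hz) as [Hz1 Hz2].
  destruct (MVT_gen (g k) x z (h k)) as [w [Hw Ew]].
  { intros w Hw. apply Dg. apply (between z w Hz1). lra. }
  { intros w Hw. apply continuity_pt_filterlim, (ex_derive_continuous (V := R_NormedModule)).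
    exists (h k w). apply Dg. now apply (between z w Hz1). }
  destruct (between z w Hz1 Hw) as [Hw1 _].
  replace (f k y - f k x - g k x * (y - x)) with (h k w * ((z - x) * (y - x)))
    by (rewrite Ez; replace (g k z) with (g k x + h k w * (z - x)) by lra; ring).
  rewrite Rabs_mult. apply Rmult_le_compat; try apply Rabs_pos.
  - now apply Hh.
  - rewrite Rabs_mult, <- (Rabs_pos_eq ((y - x) ^ 2)) by apply pow2_ge_0.
    replace ((y - x) ^ 2) with ((y - x) * (y - x)) by ring. rewrite Rabs_mult.
    apply Rmult_le_compat_r; [apply Rabs_pos | exact Hz2]. }
assert (Mpos : 0 <= Series M).
{ rewrite <- (Rmult_0_r (Series M)) at 1. rewrite <- Series_scal_r.
  apply Series_le; [|exact SM]. intros k. rewrite Rmult_0_r. split; [lra|]. eapply Rle_trans; [apply Rabs_pos | now apply (Hh k x)]. }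
apply is_derive_Reals. intros eps Heps.
(* The first two entries keep [x + u] inside the interval; the [+ 1] keeps the last quotient
   meaningful when [Series M] is zero. *)
assert (Hdel : 0 < Rmin (Rmin (x - lo) (hi - x)) (eps / (Series M + 1))).
{ repeat apply Rmin_glb_lt; try lra. apply Rdiv_lt_0_compat; lra. }
exists (mkposreal _ Hdel). simpl. intros u Hu0 Hu.
assert (Hu1 : Rabs u < x - lo) by (eapply Rlt_le_trans; [exact Hu|]; eapply Rle_trans; [apply Rmin_l|apply Rmin_l]).
assert (Hu2 : Rabs u < hi - x) by (eapply Rlt_le_trans; [exact Hu|]; eapply Rle_trans; [apply Rmin_l|apply Rmin_r]).
assert (Hu3 : Rabs u < eps / (Series M + 1)) by (eapply Rlt_le_trans; [exact Hu|apply Rmin_r]).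
assert (Hy : lo < x + u < hi) by (split; unfold Rabs in *; destruct Rcase_abs; lra).
assert (S1 : ex_series (fun k => f k (x + u) - f k x)).
{ apply (ex_series_minus (V := R_NormedModule)); now apply Sf. }
assert (S2 : ex_series (fun k => g k x * u)) by now apply ex_series_scal_r.
assert (E : Series (fun k => f k (x + u)) - Series (fun k => f k x)
            - Series (fun k => g k x) * u
          = Series (fun k => f k (x + u) - f k x - g k x * u)).
{ rewrite (Series_minus _ _ S1 S2), Series_scal_r.
  now rewrite (Series_minus _ _ (Sf _ Hy) (Sf _ Hx)). }
assert (B : Rabs (Series (fun k => f k (x + u) - f k x - g k x * u))
            <= Series M * u ^ 2).
{ assert (SM2 : ex_series (fun k => M k * u ^ 2)) by now apply ex_series_scal_r.
  assert (T : forall k, Rabs (f k (x + u) - f k x - g k x * u) <= M k * u ^ 2).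
  { intros k. generalize (taylor k (x + u) Hy).
    now replace (x + u - x) with u by ring. }
  eapply Rle_trans; [apply Series_Rabs|].
  - apply (ex_series_le (V := R_CompleteNormedModule) _ (fun k => M k * u ^ 2));
      [|exact SM2].
    intros k. change (Rabs (Rabs (f k (x + u) - f k x - g k x * u)) <= M k * u ^ 2).
    rewrite Rabs_Rabsolu. apply T.
  - rewrite <- Series_scal_r. apply Series_le; [|exact SM2].
    intros k; split; [apply Rabs_pos|apply T]. }
rewrite <- E in B.
replace (_ / u - _) with ((Series (fun k => f k (x + u)) - Series (fun k => f k x)
            - Series (fun k => g k x) * u) / u) by now field.
unfold Rdiv. rewrite Rabs_mult, Rabs_inv.
assert (Hup : 0 < Rabs u) by now apply Rabs_pos_lt.
apply Rle_lt_trans with (Series M * Rabs u).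
- apply Rmult_le_reg_r with (Rabs u); [exact Hup|].
  rewrite Rmult_assoc, Rinv_l, Rmult_1_r by lra.
  eapply Rle_trans; [exact B|]. rewrite <- (pow2_abs u). right; ring.
- apply Rle_lt_trans with ((Series M + 1) * Rabs u); [nra|].
  apply Rmult_lt_reg_r with (/ (Series M + 1)); [apply Rinv_0_lt_compat; lra|].
  replace ((Series M + 1) * Rabs u * / (Series M + 1)) with (Rabs u) by (field; lra).
  exact Hu3.
Qed.

(** * Separated modes, their superposition and its majorant *)

(** The indices [m] and [a] count the powers of k and the quarter turns of phase produced by
    differentiation, so that partial derivatives of modes are modes up to a constant. The factor
    [d ^ (n + 1)] is kept apart. *)
Definition mode (c : R) (m a k : nat) (d t s : R) : R :=
  INR k ^ m * exp (- INR k + c * INR k * s - INR k ^ 2 * d)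
  * cos (INR k ^ 2 * t + INR a * (PI / 2)).

Definition wave (c : R) (m a : nat) (d t s : R) : R :=
  Series (fun k => mode c m a k d t s).

(** The bound 1/2 leaves each mode a decay [exp (- k / 2)], uniformly down to d = 0. The product
    shape keeps axis-parallel segments inside. *)
Definition slab (c d t s : R) : Prop := 0 < d < 1 /\ Rabs (c * s) < 1 / 2.

Definition majorant (m k : nat) : R := 4 ^ m * INR (fact m) * exp (- (1 / 4)) ^ k.

Lemma exp_pow (x : R) (k : nat) : exp x ^ k = exp (INR k * x).
Proof.
induction k as [|k IH].
- now simpl; rewrite Rmult_0_l, exp_0.
- rewrite S_INR, Rmult_plus_distr_r, exp_plus, <- IH, Rmult_1_l. simpl. ring.
Qed.

Lemma exp_nondecreasing (x y : R) : x <= y -> exp x <= exp y.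
Proof. intros [H|H]; [left; now apply exp_increasing|right; now rewrite H]. Qed.

(** The quotient of [x ^ m] by m! is one term of the exponential series, all of whose terms are
    nonnegative here. *)
Lemma pow_le_fact_exp (x : R) (m : nat) : 0 <= x -> x ^ m <= INR (fact m) * exp x.
Proof.
intros Hx.
assert (F := INR_fact_lt_0 m).
apply Rmult_le_reg_r with (/ INR (fact m)); [now apply Rinv_0_lt_compat|].
replace (INR (fact m) * exp x * / INR (fact m)) with (exp x) by (field; lra).
eapply Rle_trans; [|now apply (exp_ge_taylor x m)].
assert (pos : forall k, 0 <= x ^ k / INR (fact k)).
{ intros k. apply Rmult_le_pos; [now apply pow_le|].
  left; apply Rinv_0_lt_compat, INR_fact_lt_0. }
destruct m as [|m]; [right; reflexivity|].
rewrite tech5. generalize (cond_pos_sum _ m pos). unfold Rdiv. lra.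
Qed.

Lemma majorant_pos (m k : nat) : 0 <= majorant m k.
Proof.
unfold majorant. repeat apply Rmult_le_pos.
- apply pow_le; lra.
- apply pos_INR.
- apply pow_le, Rlt_le, exp_pos.
Qed.

Lemma majorant_sum (m : nat) :
  is_series (majorant m) (4 ^ m * INR (fact m) * / (1 - exp (- (1 / 4)))).
Proof.
apply (is_series_scal_l (K := R_AbsRing) (4 ^ m * INR (fact m))
         (fun k => exp (- (1 / 4)) ^ k)), is_series_geom.
rewrite Rabs_pos_eq by apply Rlt_le, exp_pos.
apply Rlt_le_trans with (exp 0); [apply exp_increasing; lra|right; apply exp_0].
Qed.

(** The decay [exp (- k / 2)] is split in two: one factor [exp (- k / 4)] absorbs [k ^ m] at the
    cost of [4 ^ m * m!], the other is the geometric term of [majorant]. *)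
Lemma mode_bound (c : R) (m a k : nat) (d t s : R) :
  0 <= d -> Rabs (c * s) <= 1 / 2 -> Rabs (mode c m a k d t s) <= majorant m k.
Proof.
intros Hd Hs. unfold mode.
assert (Hk : 0 <= INR k) by apply pos_INR.
rewrite !Rabs_mult, (Rabs_pos_eq (INR k ^ m)) by now apply pow_le.
rewrite (Rabs_pos_eq (exp _)) by apply Rlt_le, exp_pos.
assert (Hc : Rabs (cos (INR k ^ 2 * t + INR a * (PI / 2))) <= 1)
  by apply Rabs_le, COS_bound.
assert (He : exp (- INR k + c * INR k * s - INR k ^ 2 * d)
             <= exp (- (INR k / 4)) * exp (- (INR k / 4))).
{ rewrite <- exp_plus. apply exp_nondecreasing.
  assert (c * s <= 1 / 2) by (eapply Rle_trans; [apply Rle_abs|exact Hs]).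
  assert (0 <= INR k ^ 2 * d) by (apply Rmult_le_pos; [apply pow2_ge_0|lra]).
  assert (INR k * (c * s) <= INR k * (1 / 2)) by now apply Rmult_le_compat_l.
  lra. }
assert (Hp : INR k ^ m * exp (- (INR k / 4)) <= 4 ^ m * INR (fact m)).
{ assert (H := pow_le_fact_exp (INR k / 4) m ltac:(lra)).
  apply Rmult_le_reg_r with (exp (INR k / 4)); [apply exp_pos|].
  rewrite Rmult_assoc, <- exp_plus, Rplus_opp_l, exp_0, Rmult_1_r.
  replace (INR k) with (4 * (INR k / 4)) at 1 by field.
  rewrite Rpow_mult_distr, Rmult_assoc.
  apply Rmult_le_compat_l; [apply pow_le; lra|exact H]. }
unfold majorant. rewrite exp_pow.
replace (INR k * - (1 / 4)) with (- (INR k / 4)) by field.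
set (e := exp (- (INR k / 4))) in *.
assert (0 < e) by apply exp_pos.
assert (0 <= INR k ^ m) by now apply pow_le.
apply Rle_trans with (INR k ^ m * (e * e) * 1); [|nra].
apply Rmult_le_compat; [|apply Rabs_pos| |exact Hc].
- apply Rmult_le_pos; [assumption|apply Rlt_le, exp_pos].
- now apply Rmult_le_compat_l.
Qed.

Lemma mode_ex_series (c : R) (m a : nat) (d t s : R) :
  slab c d t s -> ex_series (fun k => mode c m a k d t s).
Proof.
intros [Hd Hs].
apply (ex_series_le (V := R_CompleteNormedModule) _ (majorant m)).
- intros k. apply mode_bound; lra.
- eexists. apply majorant_sum.
Qed.

Lemma wave_bound (c : R) (m a : nat) (d t s : R) :
  slab c d t s ->
  Rabs (wave c m a d t s) <= 4 ^ m * INR (fact m) * / (1 - exp (- (1 / 4))).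
Proof.
intros [Hd Hs]. unfold wave. rewrite <- (is_series_unique _ _ (majorant_sum m)).
assert (T : forall k, Rabs (mode c m a k d t s) <= majorant m k)
  by (intros k; apply mode_bound; lra).
assert (E : ex_series (majorant m)) by (eexists; apply majorant_sum).
eapply Rle_trans; [apply Series_Rabs|].
- apply (ex_series_le (V := R_CompleteNormedModule) _ (majorant m)); [|exact E].
  intros k. change (Rabs (Rabs (mode c m a k d t s)) <= majorant m k).
  rewrite Rabs_Rabsolu. apply T.
- apply Series_le; [|exact E]. intros k; split; [apply Rabs_pos|apply T].
Qed.

(** * Partial derivatives of the superposition *)

(** Together with [dorder] and [dphase] this records the effect of one derivative on a mode. The
    constant is independent of k and leaves the sum; the dependence on k goes into the indices. *)
Definition dfactor (c : R) (i : coord) : R :=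
  match i with Cd => -1 | Ct => 1 | Cs => c end.

Definition dorder (i : coord) (m : nat) : nat :=
  match i with Cs => S m | _ => S (S m) end.

Definition dphase (i : coord) (a : nat) : nat :=
  match i with Ct => S a | _ => a end.

Lemma cos_phase_S (x : R) (a : nat) :
  cos (x + INR (S a) * (PI / 2)) = - sin (x + INR a * (PI / 2)).
Proof.
rewrite S_INR.
replace (x + (INR a + 1) * (PI / 2)) with (x + INR a * (PI / 2) + PI / 2) by ring.
rewrite cos_plus, cos_PI2, sin_PI2. ring.
Qed.

Lemma is_derive_mode (c : R) (i : coord) (m a k : nat) (d t s x : R) :
  is_derive (slice i (mode c m a k) d t s) x
    (dfactor c i * slice i (mode c (dorder i m) (dphase i a) k) d t s x).
Proof.
destruct i; unfold slice, mode, dfactor, dorder, dphase.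
- auto_derive; [easy|]. unfold Rminus. simpl. ring.
- auto_derive; [easy|]. rewrite cos_phase_S. unfold Rminus. simpl. ring.
- auto_derive; [easy|]. unfold Rminus. simpl. ring.
Qed.

Definition slice_slab (c : R) (i : coord) (d t s x : R) : Prop :=
  match i with
  | Cd => slab c x t s
  | Ct => slab c d x s
  | Cs => slab c d t x
  end.

(** Makes identities on the slab local along each coordinate line, as one-variable derivatives
    require. *)
Lemma slab_interval (c : R) (i : coord) (d t s : R) :
  0 < c -> slab c d t s ->
  exists lo hi, lo < coord_val i d t s < hi /\
    forall x, lo < x < hi -> slice_slab c i d t s x.
Proof.
intros Hc [Hd Hs]. destruct i; simpl.
- exists 0, 1. split; [exact Hd|]. now intros x Hx.
- exists (t - 1), (t + 1). split; [lra|]. now intros x Hx.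
- exists (- / (2 * c)), (/ (2 * c)).
  assert (E : / (2 * c) * c = 1 / 2) by (field; lra).
  split.
  + apply Rabs_def2 in Hs.
    split; apply Rmult_lt_reg_r with c; lra.
  + intros x Hx. split; [exact Hd|]. apply Rabs_def1; nra.
Qed.

Lemma slice_coord_val (i : coord) (f : R -> R -> R -> R) (d t s : R) :
  slice i f d t s (coord_val i d t s) = f d t s.
Proof. now destruct i. Qed.

Lemma slice_eq_on_slab (c : R) (i : coord) (f g : R -> R -> R -> R) (d t s x : R) :
  (forall d t s, slab c d t s -> f d t s = g d t s) ->
  slice_slab c i d t s x -> slice i f d t s x = slice i g d t s x.
Proof. intros H. destruct i; apply H. Qed.

Lemma is_partial_wave (c : R) (i : coord) (m a : nat) (d t s : R) :
  0 < c -> slab c d t s ->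
  is_derive (slice i (wave c m a) d t s) (coord_val i d t s)
    (dfactor c i * wave c (dorder i m) (dphase i a) d t s).
Proof.
intros Hc H. destruct (slab_interval c i d t s Hc H) as [lo [hi [Hx Hin]]].
rewrite <- (slice_coord_val i (wave c (dorder i m) (dphase i a)) d t s).
set (x := coord_val i d t s) in *.
assert (bound : forall m a k y, lo < y < hi ->
          Rabs (slice i (mode c m a k) d t s y) <= majorant m k).
{ intros m' a' k y Hy. specialize (Hin y Hy).
  destruct i; apply mode_bound; unfold slice_slab, slab in Hin; lra. }
assert (sum : forall m a y, lo < y < hi ->
          ex_series (fun k => slice i (mode c m a k) d t s y)).
{ intros m' a' y Hy. specialize (Hin y Hy).
  destruct i; now apply mode_ex_series. }
assert (E : forall m a y,
          slice i (wave c m a) d t s y = Series (fun k => slice i (mode c m a k) d t s y))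
  by now destruct i.
rewrite E, <- Series_scal_l.
apply is_derive_ext with (fun y => Series (fun k => slice i (mode c m a k) d t s y));
  [now intros y|].
(* The second derivative is once more a constant times a mode, so the majorant with the order raised
   twice serves as [M]. *)
apply is_derive_Series with
  (g := fun k y => dfactor c i * slice i (mode c (dorder i m) (dphase i a) k) d t s y)
  (h := fun k y => dfactor c i * (dfactor c i *
     slice i (mode c (dorder i (dorder i m)) (dphase i (dphase i a)) k) d t s y))
  (M := fun k => dfactor c i * dfactor c i * majorant (dorder i (dorder i m)) k)
  (lo := lo) (hi := hi); try easy.
- intros k y Hy. apply is_derive_mode.
- intros k y Hy. apply is_derive_scal, is_derive_mode.
- intros y Hy. now apply sum.
- apply (ex_series_scal_l (K := R_AbsRing) (dfactor c i)
    (fun k => slice i (mode c (dorder i m) (dphase i a) k) d t s x)).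
  now apply sum.
- intros k y Hy. rewrite <- Rmult_assoc, Rabs_mult.
  rewrite (Rabs_pos_eq (_ * _)) by nra.
  apply Rmult_le_compat_l; [nra|]. now apply bound.
- apply (ex_series_scal_l (K := R_AbsRing) (dfactor c i * dfactor c i)
    (majorant (dorder i (dorder i m)))). eexists. apply majorant_sum.
Qed.

(** * Weights in d, and joint smoothness *)

Definition weighted (c : R) (j m a : nat) (d t s : R) : R := d ^ j * wave c m a d t s.

Definition dweight (i : coord) (j : nat) : R := match i with Cd => INR j | _ => 0 end.

(** This is the product rule. For [j = 0] the default [pred 0 = 0] is harmless, since [dweight]
    vanishes there. *)
Definition weighted_partial (c : R) (i : coord) (j m a : nat) (d t s : R) : R :=
  dweight i j * weighted c (pred j) m a d t s
  + dfactor c i * weighted c j (dorder i m) (dphase i a) d t s.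

Lemma is_partial_weighted (c : R) (i : coord) (j m a : nat) (d t s : R) :
  0 < c -> slab c d t s ->
  is_derive (slice i (weighted c j m a) d t s) (coord_val i d t s)
    (weighted_partial c i j m a d t s).
Proof.
intros Hc H. assert (D := is_partial_wave c i m a d t s Hc H).
unfold weighted_partial, weighted. destruct i.
- assert (P : is_derive (fun x => x ^ j) d (INR j * d ^ pred j)).
  { auto_derive; [easy|]. ring. }
  assert (Q := is_derive_mult _ _ _ _ _ P D Rmult_comm).
  eapply eq_rect; [exact Q|]. unfold plus, mult; simpl. ring.
- assert (Q := is_derive_scal _ _ (d ^ j) _ D).
  eapply eq_rect; [exact Q|]. simpl. ring.
- assert (Q := is_derive_scal _ _ (d ^ j) _ D).
  eapply eq_rect; [exact Q|]. simpl. ring.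
Qed.

Lemma is_partial_ext (c : R) (i : coord) (f g : R -> R -> R -> R) (d t s l : R) :
  0 < c -> (forall d t s, slab c d t s -> f d t s = g d t s) -> slab c d t s ->
  is_derive (slice i f d t s) (coord_val i d t s) l ->
  is_derive (slice i g d t s) (coord_val i d t s) l.
Proof.
intros Hc E H. destruct (slab_interval c i d t s Hc H) as [lo [hi [Hx Hin]]].
apply is_derive_ext_loc.
apply (locally_interval _ _ (Finite lo) (Finite hi)); [apply Hx|apply Hx|].
intros y Hy1 Hy2. apply (slice_eq_on_slab c); [exact E|]. apply Hin. now split.
Qed.

Lemma partial_ext (c : R) (i : coord) (f g : R -> R -> R -> R) (d t s : R) :
  0 < c -> (forall d t s, slab c d t s -> f d t s = g d t s) -> slab c d t s ->
  partial i f d t s = partial i g d t s.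
Proof.
intros Hc E H. destruct (slab_interval c i d t s Hc H) as [lo [hi [Hx Hin]]].
apply Derive_ext_loc.
apply (locally_interval _ _ (Finite lo) (Finite hi)); [apply Hx|apply Hx|].
intros y Hy1 Hy2. apply (slice_eq_on_slab c); [exact E|]. apply Hin. now split.
Qed.

(* Closed under partial derivatives, with bounded members: the members are therefore
   Lipschitz, which gives joint continuity of all their derivatives. *)
Inductive wave_span (c : R) : (R -> R -> R -> R) -> Prop :=
| span_weighted (j m a : nat) : wave_span c (weighted c j m a)
| span_comb (x y : R) (f g : R -> R -> R -> R) :
    wave_span c f -> wave_span c g ->
    wave_span c (fun d t s => x * f d t s + y * g d t s)
| span_ext (f g : R -> R -> R -> R) :
    (forall d t s, slab c d t s -> f d t s = g d t s) ->
    wave_span c f -> wave_span c g.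

Lemma is_partial_comb (i : coord) (x y : R) (f g : R -> R -> R -> R) (d t s l m : R) :
  is_derive (slice i f d t s) (coord_val i d t s) l ->
  is_derive (slice i g d t s) (coord_val i d t s) m ->
  is_derive (slice i (fun d t s => x * f d t s + y * g d t s) d t s)
    (coord_val i d t s) (x * l + y * m).
Proof.
intros Hf Hg.
generalize (is_derive_plus _ _ _ _ _ (is_derive_scal _ _ x _ Hf) (is_derive_scal _ _ y _ Hg)).
now destruct i.
Qed.

(** Existence and membership go through one induction: [Derive] is total, and its linearity on a
    combination rests on the existence of both derivatives. *)
Lemma span_partial (c : R) (i : coord) (f : R -> R -> R -> R) :
  0 < c -> wave_span c f ->
  (forall d t s, slab c d t s -> ex_partial i f d t s) /\ wave_span c (partial i f).
Proof.
intros Hc Hf. induction Hf as [j m a|x y f g _ [IHf1 IHf2] _ [IHg1 IHg2]|f g E _ [IH1 IH2]].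
- split.
  + intros d t s H. eexists. now apply is_partial_weighted.
  + apply span_ext with (weighted_partial c i j m a).
    * intros d t s H. symmetry. apply is_derive_unique. now apply is_partial_weighted.
    * apply span_comb; apply span_weighted.
- assert (D : forall d t s, slab c d t s ->
      is_derive (slice i (fun d t s => x * f d t s + y * g d t s) d t s)
        (coord_val i d t s) (x * partial i f d t s + y * partial i g d t s)).
  { intros d t s H.
    apply is_partial_comb; apply Derive_correct; [now apply IHf1|now apply IHg1]. }
  split.
  + intros d t s H. eexists. now apply D.
  + apply span_ext with (fun d t s => x * partial i f d t s + y * partial i g d t s).
    * intros d t s H. symmetry. apply is_derive_unique. now apply D.
    * now apply span_comb.
- split.
  + intros d t s H. destruct (IH1 d t s H) as [l Hl]. exists l.
    now apply (is_partial_ext c i f g).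
  + apply span_ext with (partial i f); [|exact IH2].
    intros d t s H. now apply (partial_ext c).
Qed.

Lemma span_iter_partial (c : R) (l : list coord) (f : R -> R -> R -> R) :
  0 < c -> wave_span c f -> wave_span c (iter_partial l f).
Proof.
intros Hc Hf. induction l as [|i l IH]; [exact Hf|]. now apply span_partial.
Qed.

Lemma span_bounded (c : R) (f : R -> R -> R -> R) :
  wave_span c f -> exists K, forall d t s, slab c d t s -> Rabs (f d t s) <= K.
Proof.
induction 1 as [j m a|x y f g _ [K HK] _ [L HL]|f g E _ [K HK]].
- exists (1 * (4 ^ m * INR (fact m) * / (1 - exp (- (1 / 4))))).
  intros d t s H. unfold weighted. rewrite Rabs_mult.
  apply Rmult_le_compat; try apply Rabs_pos; [|now apply wave_bound].
  destruct H as [Hd _]. rewrite Rabs_pos_eq by (apply pow_le; lra).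
  rewrite <- (pow1 j). apply pow_incr. lra.
- exists (Rabs x * K + Rabs y * L). intros d t s H.
  eapply Rle_trans; [apply Rabs_triang|]. rewrite !Rabs_mult.
  apply Rplus_le_compat; apply Rmult_le_compat_l; try apply Rabs_pos; auto.
- exists K. intros d t s H. rewrite <- E by exact H. now apply HK.
Qed.

Lemma MVT_lipschitz (f : R -> R) (K x y : R) :
  (forall z, Rmin x y <= z <= Rmax x y -> ex_derive f z /\ Rabs (Derive f z) <= K) ->
  Rabs (f y - f x) <= K * Rabs (y - x).
Proof.
intros H. destruct (MVT_gen f x y (Derive f)) as [z [Hz E]].
- intros z Hz. apply Derive_correct, H. lra.
- intros z Hz. apply continuity_pt_filterlim, (ex_derive_continuous (V := R_NormedModule)).
  now apply H.
- rewrite E, Rabs_mult. apply Rmult_le_compat_r; [apply Rabs_pos|]. now apply H.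
Qed.

Lemma Rabs_mult_between_lt (c e x y z : R) :
  Rabs (c * x) < e -> Rabs (c * y) < e -> Rmin x y <= z <= Rmax x y ->
  Rabs (c * z) < e.
Proof.
intros Hx Hy Hz. apply Rabs_def2 in Hx. apply Rabs_def2 in Hy.
apply Rabs_def1; unfold Rmin, Rmax in Hz; destruct (Rle_dec x y);
  destruct (Rle_dec 0 c); nra.
Qed.

Lemma span_continuous (c d t s : R) (f : R -> R -> R -> R) :
  0 < c -> wave_span c f -> slab c d t s ->
  continuous (fun q : R * (R * R) => f (fst q) (fst (snd q)) (snd (snd q))) (d, (t, s)).
Proof.
intros Hc Hf H.
assert (B : exists K, 0 < K /\ forall i d t s, slab c d t s -> Rabs (partial i f d t s) <= K).
{ destruct (span_bounded c (partial Cd f)) as [K1 H1]; [now apply span_partial|].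
  destruct (span_bounded c (partial Ct f)) as [K2 H2]; [now apply span_partial|].
  destruct (span_bounded c (partial Cs f)) as [K3 H3]; [now apply span_partial|].
  exists (1 + Rabs K1 + Rabs K2 + Rabs K3).
  assert (A1 := Rle_abs K1). assert (A2 := Rle_abs K2). assert (A3 := Rle_abs K3).
  assert (P1 := Rabs_pos K1). assert (P2 := Rabs_pos K2). assert (P3 := Rabs_pos K3).
  split; [lra|]. intros i d' t' s' H'.
  specialize (H1 _ _ _ H'). specialize (H2 _ _ _ H'). specialize (H3 _ _ _ H').
  destruct i; lra. }
destruct B as [K [HK B]].
assert (D : forall i d t s, slab c d t s -> ex_partial i f d t s)
  by (intros i; now apply span_partial).
(* The two points are joined by three axis-parallel segments in the slab, each handled by the mean
   value theorem in one variable. *)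
assert (L : forall d' t' s', slab c d' t' s' ->
   Rabs (f d' t' s' - f d t s) <= K * (Rabs (d' - d) + Rabs (t' - t) + Rabs (s' - s))).
{ intros d' t' s' [Hd' Hs']. destruct H as [Hd Hs].
  assert (L1 : Rabs (f d' t' s' - f d t' s') <= K * Rabs (d' - d)).
  { apply (MVT_lipschitz (fun z => f z t' s')). intros z Hz.
    assert (Hz' : slab c z t' s').
    { split; [|exact Hs']. unfold Rmin, Rmax in Hz. destruct (Rle_dec d d'); lra. }
    split; [now apply (D Cd)|now apply (B Cd)]. }
  assert (L2 : Rabs (f d t' s' - f d t s') <= K * Rabs (t' - t)).
  { apply (MVT_lipschitz (fun z => f d z s')). intros z Hz.
    assert (Hz' : slab c d z s') by now split.
    split; [now apply (D Ct)|now apply (B Ct)]. }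
  assert (L3 : Rabs (f d t s' - f d t s) <= K * Rabs (s' - s)).
  { apply (MVT_lipschitz (fun z => f d t z)). intros z Hz.
    assert (Hz' : slab c d t z).
    { split; [exact Hd|]. now apply Rabs_mult_between_lt with s s'. }
    split; [now apply (D Cs)|now apply (B Cs)]. }
  replace (f d' t' s' - f d t s) with
    ((f d' t' s' - f d t' s') + (f d t' s' - f d t s') + (f d t s' - f d t s)) by ring.
  eapply Rle_trans; [apply Rabs_triang|].
  generalize (Rabs_triang (f d' t' s' - f d t' s') (f d t' s' - f d t s')). lra. }
apply filterlim_locally. intros [eps Heps]. simpl fst. simpl snd.
destruct (slab_interval c Cd d t s Hc H) as [lo [hi [Hx Hin]]].
destruct (slab_interval c Cs d t s Hc H) as [lo' [hi' [Hx' Hin']]].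
simpl in Hx, Hin, Hx', Hin'.
(* Only d and s are confined by the slab; [eps / (3 * K)] shares the tolerance among the three
   segments. *)
assert (Hdel : 0 < Rmin (Rmin (Rmin (d - lo) (hi - d)) (Rmin (s - lo') (hi' - s))) (eps / (3 * K))).
{ repeat apply Rmin_glb_lt; try lra. apply Rdiv_lt_0_compat; lra. }
exists (mkposreal _ Hdel). simpl. intros [d' [t' s']] [Bd [Bt Bs]]. simpl in Bd, Bt, Bs.
change (Rabs (d' - d) < Rmin (Rmin (Rmin (d - lo) (hi - d)) (Rmin (s - lo') (hi' - s))) (eps / (3 * K))) in Bd.
change (Rabs (t' - t) < Rmin (Rmin (Rmin (d - lo) (hi - d)) (Rmin (s - lo') (hi' - s))) (eps / (3 * K))) in Bt.
change (Rabs (s' - s) < Rmin (Rmin (Rmin (d - lo) (hi - d)) (Rmin (s - lo') (hi' - s))) (eps / (3 * K))) in Bs.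
change (Rabs (f d' t' s' - f d t s) < eps).
apply Rmin_Rgt_l in Bd. apply Rmin_Rgt_l in Bt. apply Rmin_Rgt_l in Bs.
destruct Bd as [Bd Ed]. destruct Bt as [Bt Et]. destruct Bs as [Bs Es].
apply Rmin_Rgt_l in Bd. apply Rmin_Rgt_l in Bs.
destruct Bd as [Bd _]. destruct Bs as [_ Bs].
apply Rmin_Rgt_l in Bd. apply Rmin_Rgt_l in Bs.
assert (H1 : slab c d' t s).
{ apply Hin. split; unfold Rabs in Bd; destruct Rcase_abs; lra. }
assert (H2 : slab c d t s').
{ apply Hin'. split; unfold Rabs in Bs; destruct Rcase_abs; lra. }
assert (H3 : slab c d' t' s') by (split; [apply H1|apply H2]).
eapply Rle_lt_trans; [now apply L|].
apply Rlt_le_trans with (K * (eps / (3 * K) + eps / (3 * K) + eps / (3 * K))).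
- apply Rmult_lt_compat_l; lra.
- right. field. lra.
Qed.

(** * The differential equation *)

Lemma partial_weighted (c : R) (i : coord) (j m a : nat) (d t s : R) :
  0 < c -> slab c d t s ->
  partial i (weighted c j m a) d t s = weighted_partial c i j m a d t s.
Proof. intros Hc H. apply is_derive_unique. now apply is_partial_weighted. Qed.

Lemma partial2_weighted (c : R) (i : coord) (j m a : nat) (d t s : R) :
  0 < c -> slab c d t s ->
  partial i (partial i (weighted c j m a)) d t s
  = dweight i j * weighted_partial c i (pred j) m a d t s
    + dfactor c i * weighted_partial c i j (dorder i m) (dphase i a) d t s.
Proof.
intros Hc H.
rewrite (partial_ext c i _ (weighted_partial c i j m a)); try assumption.
- apply is_derive_unique, is_partial_comb; now apply is_partial_weighted.
- intros. now apply partial_weighted.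
Qed.

(** Two quarter turns change the sign of the cosine; this is the sign of the second t-derivative. *)
Lemma wave_half_turn (c : R) (m a : nat) (d t s : R) :
  wave c m (S (S a)) d t s = - wave c m a d t s.
Proof.
unfold wave. rewrite <- Series_opp. apply Series_ext. intros k. unfold mode.
rewrite cos_phase_S, S_INR.
replace (INR k ^ 2 * t + (INR a + 1) * (PI / 2))
  with (INR k ^ 2 * t + INR a * (PI / 2) + PI / 2) by ring.
rewrite sin_plus, cos_PI2, sin_PI2. ring.
Qed.

(** Collecting by order in k: the [w4] terms of the dd- and tt-derivatives cancel, the coefficient
    of [w2] is a multiple of [c * c - n - 3], and that of [w0] is a multiple of [(n + 1) * n - (n -
    1) * (n + 1) - (n + 1) = 0]. *)
Lemma weighted_solves (n : nat) (c d t s : R) :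
  (1 <= n)%nat -> 0 < c -> c * c = INR n + 3 -> slab c d t s ->
  let v := weighted c (S n) 0 0 in
  d ^ 2 * iter_partial (Cd :: Cd :: nil) v d t s
  + d ^ 2 * iter_partial (Ct :: Ct :: nil) v d t s
  + d * iter_partial (Cs :: Cs :: nil) v d t s
  - (INR n - 1) * d * iter_partial (Cd :: nil) v d t s
  - (INR n + 1) * v d t s = 0.
Proof.
intros Hn Hc Ec H v. unfold v. cbn [iter_partial fold_right].
rewrite !partial2_weighted, partial_weighted by assumption.
destruct n as [|n]; [lia|].
unfold weighted_partial, weighted, dweight, dfactor, dorder, dphase.
rewrite !wave_half_turn. cbn [pred pow]. rewrite !S_INR in *.
set (w0 := wave c 0 0 d t s). set (w2 := wave c 2 0 d t s).
set (w4 := wave c 4 0 d t s).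
(* Since the case split, [n] stands for the original exponent minus one, hence 4 in place of 3. *)
replace (INR n) with (c * c - 4) by lra. ring.
Qed.

(** * Gevrey estimates in the tangential variables *)

(** This is the bound [4 ^ p] for the central binomial coefficient. It turns the (2p)! coming from
    up to 2p powers of k into the square of p!. *)
Lemma fact_double_le (p : nat) : INR (fact (2 * p)) <= 4 ^ p * INR (fact p) ^ 2.
Proof.
induction p as [|p IH]; [simpl; lra|].
replace (2 * S p)%nat with (S (S (2 * p))) by lia.
rewrite !fact_simpl, !mult_INR, !S_INR, mult_INR. simpl (INR 2).
assert (F := INR_fact_lt_0 (2 * p)). assert (P := pos_INR p).
replace (4 ^ S p * ((INR p + 1) * INR (fact p)) ^ 2)
  with ((2 * (INR p + 1)) * ((2 * (INR p + 1)) * (4 ^ p * INR (fact p) ^ 2)))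
  by (simpl; ring).
apply Rmult_le_compat; nra.
Qed.

(** Tangential derivatives do not touch [d ^ j], so no sums arise. Each step contributes a factor 1
    or [c], at most [c] because [1 <= c], and at most two powers of k. *)
Lemma iter_tangential_weighted (c : R) (j : nat) (l : list coord) :
  1 <= c -> ~ In Cd l ->
  exists (q : R) (m a : nat), Rabs q <= c ^ length l /\ (m <= 2 * length l)%nat /\
    forall d t s, slab c d t s ->
      iter_partial l (weighted c j 0 0) d t s = q * weighted c j m a d t s.
Proof.
intros Hc. induction l as [|i l IH]; intros Hl.
- exists 1, 0%nat, 0%nat. rewrite Rabs_R1. simpl. repeat split; [lra|lia|].
  intros; ring.
- destruct IH as [q [m [a [Hq [Hm E]]]]]; [firstorder|].
  assert (Hi : i <> Cd) by (intros ->; apply Hl; now left).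
  exists (q * dfactor c i), (dorder i m), (dphase i a). repeat split.
  + rewrite Rabs_mult. simpl. rewrite Rmult_comm.
    apply Rmult_le_compat; try apply Rabs_pos; [|exact Hq].
    destruct i; [easy|..]; simpl; rewrite Rabs_pos_eq; lra.
  + destruct i; simpl in *; lia.
  + intros d t s H. simpl.
    rewrite (partial_ext c i _ (fun d t s => q * weighted c j m a d t s)); try easy; [|lra].
    assert (D := is_derive_scal _ _ q _
                   (is_partial_weighted c i j m a d t s ltac:(lra) H)).
    transitivity (q * weighted_partial c i j m a d t s).
    * apply is_derive_unique. now destruct i.
    * unfold weighted_partial. destruct i; [easy|..]; simpl; ring.
Qed.

Lemma weighted_gevrey (c : R) (j : nat) :
  1 <= c -> tangential_gevrey2_on (slab c) (weighted c j 0 0).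
Proof.
intros Hc.
set (A := / (1 - exp (- (1 / 4)))).
assert (HA : 0 < A).
{ apply Rinv_0_lt_compat.
  assert (exp (- (1 / 4)) < exp 0) by (apply exp_increasing; lra).
  rewrite exp_0 in *. lra. }
(* [A] sums the geometric series. In [64 = 4 ^ 2 * 4], the square comes from [4 ^ (2 * p)] in
   [wave_bound], the last 4 from [fact_double_le], and [c] from the derivative factors. *)
exists A, (c * 64). split; [exact HA|]. split; [lra|].
intros p l Hp Hl d t s H.
destruct (iter_tangential_weighted c j l Hc Hl) as [q [m [a [Hq [Hm E]]]]].
rewrite Hp in Hq, Hm. rewrite E by exact H. unfold weighted.
assert (W := wave_bound c m a d t s H). fold A in W.
assert (Hd : Rabs (d ^ j) <= 1).
{ destruct H as [Hd _]. rewrite Rabs_pos_eq by (apply pow_le; lra).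
  rewrite <- (pow1 j). apply pow_incr. lra. }
assert (F : 4 ^ m * INR (fact m) <= 64 ^ p * INR (fact p) ^ 2).
{ apply Rle_trans with (4 ^ (2 * p) * INR (fact (2 * p))).
  - apply Rmult_le_compat; [apply pow_le; lra|apply pos_INR| |].
    + apply Rle_pow; [lra|exact Hm].
    + apply le_INR, fact_le, Hm.
  - rewrite pow_mult. replace (64 ^ p) with ((4 ^ 2) ^ p * 4 ^ p)
      by (rewrite <- Rpow_mult_distr; f_equal; lra).
    rewrite Rmult_assoc. apply Rmult_le_compat_l; [apply pow_le; lra|].
    apply fact_double_le. }
rewrite !Rabs_mult.
replace (A * (c * 64) ^ p * INR (fact p) ^ 2)
  with (c ^ p * (1 * (64 ^ p * INR (fact p) ^ 2 * A)))
  by (rewrite Rpow_mult_distr; ring).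
repeat apply Rmult_le_compat; try apply Rmult_le_pos; try apply Rabs_pos; try assumption.
eapply Rle_trans; [exact W|]. apply Rmult_le_compat_r; lra.
Qed.

(** * Failure of analyticity at the boundary *)

Lemma term_le_Series (a : nat -> R) (k : nat) :
  (forall n, 0 <= a n) -> ex_series a -> a k <= Series a.
Proof.
intros Ha Sa. rewrite (Series_incr_n a (S k)) by (lia || assumption).
assert (T : 0 <= Series (fun i => a (S k + i)%nat)).
{ assert (Sa' : ex_series (fun i => a (S k + i)%nat)) by now apply (ex_series_incr_n a (S k)).
  rewrite <- (Rmult_0_r (Series (fun i => a (S k + i)%nat))) at 1.
  rewrite <- Series_scal_r. apply Series_le; [|exact Sa'].
  intros i. rewrite Rmult_0_r. split; [lra|apply Ha]. }
simpl pred. destruct k as [|k]; [simpl sum_f_R0; lra|].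
rewrite tech5. generalize (cond_pos_sum _ k Ha). lra.
Qed.

Lemma is_pseries_CV_radius (a : nat -> R) (x l : R) :
  is_pseries a x l -> Rbar_le (Rabs x) (CV_radius a).
Proof.
intros H. apply Rbar_not_lt_le. intros Hlt.
apply (CV_disk_outside a x Hlt). apply ex_series_lim_0.
exists l. now apply is_pseries_R.
Qed.

(** Convergence at the midpoint of [x] and [del] pushes the radius beyond [x]; one-sided convergence
    thus controls a full disc about 0. *)
Lemma half_line_CV_radius (a : nat -> R) (f : R -> R) (del x : R) :
  (forall h, 0 < h < del -> is_pseries a h (f h)) -> 0 <= x < del ->
  Rbar_lt (Rabs x) (CV_radius a).
Proof.
intros H Hx.
apply Rbar_lt_le_trans with (Finite (Rabs ((x + del) / 2))).
- simpl. rewrite !Rabs_pos_eq; lra.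
- apply is_pseries_CV_radius with (f ((x + del) / 2)). apply H. lra.
Qed.

(** Carries to the endpoint inequalities known only for h > 0; below, the value at 0 reads off a
    power series coefficient. *)
Lemma continuity_pt_nonneg_right (g : R -> R) (del : R) :
  0 < del -> continuity_pt g 0 -> (forall h, 0 < h < del -> 0 <= g h) -> 0 <= g 0.
Proof.
intros Hdel Cg H. destruct (Rle_lt_dec 0 (g 0)) as [|Hneg]; [assumption|].
destruct (Cg (- g 0)) as [e [He Hg]]; [lra|].
assert (Hm : 0 < Rmin e del) by now apply Rmin_glb_lt.
assert (L1 := Rmin_l e del). assert (L2 := Rmin_r e del).
assert (A : Rabs (g (Rmin e del / 2) - g 0) < - g 0).
{ apply Hg. split; [split; [exact I|lra]|].
  simpl. unfold R_dist. rewrite Rminus_0_r, Rabs_pos_eq; lra. }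
specialize (H (Rmin e del / 2) ltac:(lra)).
apply Rabs_def2 in A. lra.
Qed.

(** Strips the weight [d ^ j] one factor at a time: since [T] is bounded, the product tends to 0
    with h, so the constant coefficient vanishes and the series can be shifted down. *)
Lemma is_pseries_divide_pow (j : nat) (T : R -> R) (K del : R) :
  0 < del <= 1 -> (forall h, 0 < h < del -> Rabs (T h) <= K) ->
  forall a, (forall h, 0 < h < del -> is_pseries a h (h ^ j * T h)) ->
  exists b, forall h, 0 < h < del -> is_pseries b h (T h).
Proof.
intros Hdel HT. induction j as [|j IH]; intros a Ha.
- exists a. intros h Hh. rewrite <- (Rmult_1_l (T h)). now apply Ha.
- assert (a0 : a 0%nat = 0).
  { assert (P : 0 <= K * 0 - Rabs (PSeries a 0)).
    { apply (continuity_pt_nonneg_right (fun h => K * h - Rabs (PSeries a h)) del); [lra| |].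
      - apply continuity_pt_minus; [apply derivable_continuous_pt; reg|].
        apply (continuity_pt_comp (PSeries a) Rabs); [|apply Rcontinuity_abs].
        apply PSeries_continuity.
        apply (half_line_CV_radius a (fun h => h ^ S j * T h) del); [exact Ha|lra].
      - intros h Hh. rewrite (is_pseries_unique _ _ _ (Ha h Hh)).
        rewrite Rabs_mult, Rabs_pos_eq by (apply pow_le; lra).
        specialize (HT h Hh). assert (Hp : h ^ j <= 1 ^ j) by (apply pow_incr; lra).
        rewrite pow1 in Hp. assert (0 <= h ^ j) by (apply pow_le; lra).
        assert (Q := Rabs_pos (T h)).
        assert (h ^ S j * Rabs (T h) <= h * K); [|lra].
        apply Rmult_le_compat; simpl; nra. }
    rewrite PSeries_0 in P. assert (Q := Rabs_pos (a 0%nat)).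
    destruct (Req_dec (a 0%nat) 0) as [|Hne]; [assumption|].
    apply Rabs_pos_lt in Hne. lra. }
  apply (IH (PS_decr_1 a)). intros h Hh.
  assert (D := is_pseries_decr_1 a h (/ h) (h ^ S j * T h)
                 ltac:(apply Rinv_l; lra) (Ha h Hh)).
  rewrite a0 in D. eapply eq_rect; [exact D|].
  unfold scal, plus, opp; simpl; unfold mult; simpl. field. lra.
Qed.

Lemma Derive_n_wave (c : R) (m p : nat) (h : R) :
  0 < c -> 0 < h < 1 ->
  Derive_n (fun x => wave c m 0 x 0 0) p h = (-1) ^ p * wave c (2 * p + m) 0 h 0 0.
Proof.
intros Hc. revert h. induction p as [|p IH]; intros h Hh; [simpl; ring|].
cbn [Derive_n].
rewrite (Derive_ext_loc _ (fun x => (-1) ^ p * wave c (2 * p + m) 0 x 0 0)).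
- assert (H : slab c h 0 0) by (split; [exact Hh|rewrite Rmult_0_r, Rabs_R0; lra]).
  assert (D := is_derive_scal _ _ ((-1) ^ p) _
                 (is_partial_wave c Cd (2 * p + m) 0 h 0 0 Hc H)).
  apply is_derive_unique in D. eapply eq_trans; [exact D|].
  replace (2 * S p + m)%nat with (S (S (2 * p + m))) by lia. simpl. ring.
- apply (locally_interval _ _ (Finite 0) (Finite 1)); simpl; try lra.
  intros y H0 H1. now apply IH.
Qed.

(** At t = s = 0 every cosine equals 1, so all terms are nonnegative and any single one minorizes
    the sum. *)
Lemma wave_lower_bound (c : R) (m k : nat) (h : R) :
  0 < h < 1 -> INR k ^ m * exp (- INR k - INR k ^ 2 * h) <= wave c m 0 h 0 0.
Proof.
intros Hh.
assert (E : forall i, mode c m 0 i h 0 0 = INR i ^ m * exp (- INR i - INR i ^ 2 * h)).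
{ intros i. unfold mode. rewrite Rmult_0_r, Rplus_0_r.
  replace (INR i ^ 2 * 0 + INR 0 * (PI / 2)) with 0 by (simpl; ring).
  rewrite cos_0. ring. }
rewrite <- E. apply (term_le_Series (fun k => mode c m 0 k h 0 0)).
- intros i. rewrite E. apply Rmult_le_pos; [apply pow_le, pos_INR|apply Rlt_le, exp_pos].
- apply mode_ex_series. split; [exact Hh|rewrite Rmult_0_r, Rabs_R0; lra].
Qed.

Lemma fact_le_pow (p : nat) : INR (fact p) <= INR p ^ p.
Proof.
assert (H : forall q, (q <= p)%nat -> INR (fact q) <= INR p ^ q).
{ induction q as [|q IH]; intros Hq; [simpl; lra|].
  rewrite fact_simpl, mult_INR. simpl pow.
  apply Rmult_le_compat; [apply pos_INR|apply pos_INR|now apply le_INR|apply IH; lia]. }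
now apply H.
Qed.

Lemma wave_not_pseries (c : R) (b : nat -> R) (del : R) :
  0 < c -> 0 < del <= 1 ->
  ~ (forall h, 0 < h < del -> is_pseries b h (wave c 0 0 h 0 0)).
Proof.
intros Hc Hdel Hb.
assert (rad : forall x, 0 <= x < del -> Rbar_lt (Rabs x) (CV_radius b)).
{ intros x Hx. now apply (half_line_CV_radius b (fun h => wave c 0 0 h 0 0) del). }
set (r := del / 2).
assert (Sb := CV_disk_inside b r (rad r ltac:(unfold r; lra))).
set (M := Series (fun p => Rabs (b p * r ^ p))).
assert (HM : forall p, Rabs (b p * r ^ p) <= M).
{ intros p. apply (term_le_Series (fun p => Rabs (b p * r ^ p))); [|exact Sb].
  intros; apply Rabs_pos. }
(* In the p-th derivative only the mode k = p is kept, and h tends to 0 from the right, where that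
   derivative becomes p! times [b p]. *)
assert (low : forall p, INR p ^ (2 * p) * exp (- INR p) <= INR (fact p) * Rabs (b p)).
{ intros p.
  assert (P : 0 <= Rabs (PSeries (PS_derive_n p b) 0)
                   - INR p ^ (2 * p) * exp (- INR p - INR p ^ 2 * 0)).
  { apply (continuity_pt_nonneg_right (fun h => Rabs (PSeries (PS_derive_n p b) h)
              - INR p ^ (2 * p) * exp (- INR p - INR p ^ 2 * h)) del); [lra| |].
    - apply continuity_pt_minus.
      + apply (continuity_pt_comp (PSeries (PS_derive_n p b)) Rabs); [|apply Rcontinuity_abs].
        apply PSeries_continuity. rewrite CV_radius_derive_n. apply rad. lra.
      + apply derivable_continuous_pt. reg.
    - intros h Hh. rewrite <- Derive_n_PSeries by (apply rad; lra).
      rewrite (Derive_n_ext_loc _ (fun x => wave c 0 0 x 0 0)).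
      + rewrite Derive_n_wave by lra. rewrite Nat.add_0_r, Rabs_mult, pow_1_abs, Rmult_1_l.
        assert (L := wave_lower_bound c (2 * p) p h ltac:(lra)).
        generalize (Rle_abs (wave c (2 * p) 0 h 0 0)). lra.
      + apply (locally_interval _ _ (Finite 0) (Finite del)); simpl; try lra.
        intros y H0 H1. apply is_pseries_unique. now apply Hb. }
  rewrite PSeries_0 in P. unfold PS_derive_n in P.
  rewrite Rmult_0_r, Rminus_0_r, Rabs_mult in P. simpl (0 + p)%nat in P.
  replace (INR (fact p) / INR (fact 0)) with (INR (fact p)) in P by (simpl; field).
  rewrite (Rabs_pos_eq (INR (fact p))) in P by apply pos_INR. lra. }
assert (r0 : 0 < r) by (unfold r; lra).
(* Dividing [low] by [p ^ p], which dominates p!, leaves [p ^ p * exp (- p)] below the modulus of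
   [b p]; convergence at [r] caps it by [M]. *)
assert (grow : forall p, (1 <= p)%nat -> (INR p * r * exp (-1)) ^ p <= M).
{ intros p Hp. apply lt_INR in Hp; simpl in Hp.
  assert (Hpp : 0 < INR p ^ p) by (apply pow_lt; lra).
  assert (Hr : 0 < r ^ p) by now apply pow_lt.
  eapply Rle_trans; [|apply (HM p)]. rewrite Rabs_mult, (Rabs_pos_eq (r ^ p)) by lra.
  assert (L := low p). replace (2 * p)%nat with (p + p)%nat in L by lia.
  rewrite pow_add in L.
  replace (- INR p) with (INR p * -1) in L by ring. rewrite <- exp_pow in L.
  rewrite !Rpow_mult_distr.
  assert (L2 : INR p ^ p * (INR p ^ p * exp (-1) ^ p) <= INR p ^ p * Rabs (b p)).
  { rewrite <- Rmult_assoc. eapply Rle_trans; [exact L|].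
    apply Rmult_le_compat_r; [apply Rabs_pos|apply fact_le_pow]. }
  apply Rmult_le_reg_l in L2; [|exact Hpp].
  replace (INR p ^ p * r ^ p * exp (-1) ^ p) with (INR p ^ p * exp (-1) ^ p * r ^ p) by ring.
  apply Rmult_le_compat_r; lra. }
assert (e0 := exp_pos (-1)).
assert (re : 0 < r * exp (-1)) by now apply Rmult_lt_0_compat.
(* Such a [p] makes the base in [grow] at least 2, so [2 ^ p <= M < p], against the Bernoulli
   inequality [1 + p <= 2 ^ p]. *)
destruct (INR_unbounded (Rmax M (2 / (r * exp (-1))))) as [p Hp].
assert (Hp1 : M < INR p) by (eapply Rle_lt_trans; [apply Rmax_l|exact Hp]).
assert (Hp2 : 2 / (r * exp (-1)) < INR p) by (eapply Rle_lt_trans; [apply Rmax_r|exact Hp]).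
assert (Hpos : 0 < 2 / (r * exp (-1))) by (apply Rdiv_lt_0_compat; lra).
assert (Hbig : 2 <= INR p * r * exp (-1)).
{ apply (Rmult_lt_compat_r (r * exp (-1))) in Hp2; [|exact re].
  replace (2 / (r * exp (-1)) * (r * exp (-1))) with 2 in Hp2 by (field; lra). lra. }
assert (G1 := grow p ltac:(apply INR_le; simpl; apply Rnot_lt_le; intros Hlt;
   apply (INR_lt p 1) in Hlt; assert (p = 0)%nat by lia; subst p; simpl in *; lra)).
assert (G2 : 2 ^ p <= (INR p * r * exp (-1)) ^ p) by (apply pow_incr; lra).
assert (G3 := poly p 1 ltac:(lra)). replace (1 + 1) with 2 in G3 by ring. lra.
Qed.

(** On the axis the double series becomes a power series in one variable; the surviving term i = m
    uses [0 ^ 0 = 1]. *)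
Lemma sum_homogeneous_axis (c : nat -> nat -> R) (h : R) (m : nat) :
  sum_f_R0 (fun i => c i (m - i)%nat * h ^ i * 0 ^ (m - i)) m = c m 0%nat * h ^ m.
Proof.
destruct m as [|m]; [simpl; ring|].
rewrite tech5, Nat.sub_diag, sum_eq_R0; [simpl; ring|].
intros i Hi. rewrite (pow_i (S m - i)) by lia. ring.
Qed.

Lemma weighted_not_analytic (c : R) (j : nat) :
  0 < c -> ~ analytic_up_to_boundary_at_origin (fun d t => weighted c j 0 0 d t 0).
Proof.
intros Hc [F [HA HF]].
apply locally_singleton in HA. destruct HA as [a [rho [Hrho Ha]]].
destruct HF as [[eps Heps] HF].
(* Below 1 the bounds on the slab apply, below [rho] the expansion of [F] holds, and below [eps] it
   agrees with the solution. *)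
set (del := Rmin 1 (Rmin rho eps)).
assert (D1 : del <= 1) by apply Rmin_l.
assert (D2 : del <= rho) by (eapply Rle_trans; [apply Rmin_r|apply Rmin_l]).
assert (D3 : del <= eps) by (eapply Rle_trans; [apply Rmin_r|apply Rmin_r]).
assert (D0 : 0 < del) by (unfold del; repeat apply Rmin_glb_lt; lra).
assert (P : forall h, 0 < h < del ->
          is_pseries (fun m => a m 0%nat) h (h ^ j * wave c 0 0 h 0 0)).
{ intros h Hh. apply is_pseries_R.
  destruct (Ha h 0) as [_ S]; [rewrite Rabs_pos_eq; lra|rewrite Rabs_R0; lra|].
  simpl fst in S. simpl snd in S. rewrite !Rplus_0_l in S.
  rewrite HF in S.
  - eapply is_series_ext; [|exact S]. intros m. apply sum_homogeneous_axis.
  - split; [|apply ball_center]. change (Rabs (h - 0) < eps).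
    rewrite Rminus_0_r, Rabs_pos_eq; lra.
  - simpl. lra. }
destruct (is_pseries_divide_pow j (fun h => wave c 0 0 h 0 0)
            (4 ^ 0 * INR (fact 0) * / (1 - exp (- (1 / 4)))) del ltac:(lra)) with (2 := P)
  as [b Hb].
- intros h Hh. apply wave_bound. split; [lra|rewrite Rmult_0_r, Rabs_R0; lra].
- now apply (wave_not_pseries c b del).
Qed.

(** * From the slab to the domain of the theorem *)

Lemma smooth_on_span (c : R) (f : R -> R -> R -> R) :
  0 < c -> wave_span c f -> smooth_on (slab c) f.
Proof.
intros Hc Hf l d t s H. assert (Hl := span_iter_partial c l f Hc Hf). split.
- intros i. now apply (span_partial c i (iter_partial l f)).
- now apply (span_continuous c).
Qed.

(** The radius is chosen so that [Rabs s < / (2 * c)] reads [Rabs (c * s) < 1 / 2]; with [1 <= c] it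
    is also at most 1/2, which bounds d by 1. *)
Lemma G_slab (c d t s : R) : 1 <= c -> G (/ (2 * c)) d t s -> slab c d t s.
Proof.
intros Hc [Hd Hts].
assert (Hr : / (2 * c) * c = 1 / 2) by (field; lra).
assert (Hr0 : 0 < / (2 * c)) by (apply Rinv_0_lt_compat; lra).
split; [nra|].
assert (Hs : Rabs s < / (2 * c)).
{ rewrite <- (Rabs_pos_eq (/ (2 * c))) by lra.
  apply Rsqr_lt_abs_0. unfold Rsqr. nra. }
rewrite Rabs_mult, (Rabs_pos_eq c) by lra. nra.
Qed.

Theorem mainTheorem4 (n : nat) (hn : (2 <= n)%nat) :
  exists (r : R) (v : R -> R -> R -> R),
    0 < r /\
    smooth_on (G r) v /\
    solves_on n (G r) v /\
    tangential_gevrey2_on (G r) v /\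
    ~ analytic_up_to_boundary_at_origin (fun d t => v d t 0).
Proof.
set (c := sqrt (INR n + 3)).
assert (Hn := pos_INR n).
assert (Ec : c * c = INR n + 3) by (apply sqrt_sqrt; lra).
assert (Hc : 1 <= c) by (rewrite <- sqrt_1; apply sqrt_le_1; lra).
exists (/ (2 * c)), (weighted c (S n) 0 0).
assert (GS : forall d t s, G (/ (2 * c)) d t s -> slab c d t s)
  by (intros d t s; now apply G_slab).
repeat split.
- apply Rinv_0_lt_compat; lra.
- apply (smooth_on_span c); [lra|apply span_weighted|now apply GS].
- apply (smooth_on_span c); [lra|apply span_weighted|now apply GS].
- intros d t s H. apply weighted_solves; [lia|lra|exact Ec|now apply GS].
- destruct (weighted_gevrey c (S n) Hc) as [D [B [HD [HB H]]]].
  exists D, B. repeat split; try assumption. intros; apply H; auto.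
- apply weighted_not_analytic. lra.
Qed.
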